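(* Let $\mathbb{K}$ be an algebraically closed field with a (Krull) valuation $\mathrm{val}:\mathbb{K}\to\Gamma\cup\{\infty\}$ onto a totally ordered abelian group $\Gamma$ together with $\infty$. For every non-zero polynomial $f\in\mathbb{K}[x]$ in one variable, $$\mathcal{V}(\mathcal{T}f)=\mathbf{TV}f\quad\text{as subsets of }\Gamma.$$
   Context: A totally ordered group is an abelian group $(\Gamma,+)$ with a total order such that $x\le y$ implies $x+z\le y+z$. A valuation on a field $\mathbb{K}$ with group of values $\Gamma$ is a surjective map $\mathrm{val}:\mathbb{K}\to\Gamma\cup\{\infty\}$ (with $\infty$ larger than every element of $\Gamma$ and $a+\infty=\infty$) such that $\mathrm{val}(x)=\infty\iff x=0$, $\mathrm{val}(xy)=\mathrm{val}(x)+\mathrm{val}(y)$, and $\mathrm{val}(x+y)\ge\min\{\mathrm{val}(x),\mathrm{val}(y)\}$. Write a non-zero polynomial as $f=\sum_{j\in\mathcal{E}(f)}\varphi_j x^j$ with $\mathcal{E}(f)$ a finite non-empty set of exponents and all $\varphi_j\in\mathbb{K}\setminus\{0\}$. Its tropicalization $\mathcal{T}f$ induces the map $\Gamma\to\Gamma$, $\gamma\mapsto\min_{j\in\mathcal{E}(f)}(\mathrm{val}(\varphi_j)+j\gamma)$. The hypersurface associated to $\mathcal{T}f$ is the set $\mathcal{V}(\mathcal{T}f)$ of $\gamma\in\Gamma$ for which this minimum is attained for at least two exponents $j\in\mathcal{E}(f)$. The set of zeroes of $f$ is $\mathbf{V}(f)=\{x\in\mathbb{K}\setminus\{0\}: f(x)=0\}$,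 and the tropical hypersurface associated to $f$ is $\mathbf{TV}f=\{\mathrm{val}(x):x\in\mathbf{V}(f)\}$. *)

(* Defs.v *)
From HB Require Import structures.
From mathcomp Require Import all_boot all_order all_algebra.
From mathcomp Require Import classical_sets.

Set Implicit Arguments.
Unset Strict Implicit.
Unset Printing Implicit Defensive.

Import Order.TTheory GRing.Theory Num.Theory.
Local Open Scope classical_set_scope.
Local Open Scope ring_scope.

HB.mixin Record POrderedZmodule_isOrderedGroup G of Num.POrderedZmodule G := {
  ordered_group_total : total (<=%R : rel G);
  ordered_group_leD : forall x y z : G, x <= y -> x + z <= y + z
}.

#[short(type="orderedGroupType")]
HB.structure Definition OrderedGroup :=
  { G of Num.POrderedZmodule G & POrderedZmodule_isOrderedGroup G }.

(* [extended G] is the disjoint union of G and {oo}, with [None] as oo.       *)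
Notation extended G := (option G).

Section Extended.
Variable G : orderedGroupType.
Implicit Types a b : extended G.

Definition ext_add a b : extended G :=
  match a, b with
  | Some x, Some y => Some (x + y)
  | _, _ => None
  end.

Definition ext_le a b : bool :=
  match a, b with
  | _, None => true
  | None, Some _ => false
  | Some x, Some y => x <= y
  end.

Definition ext_min a b : extended G := if ext_le a b then a else b.

End Extended.

Record valuation (K : fieldType) (G : orderedGroupType) := Valuation {
  valuation_fun :> K -> extended G;
  valuation_surj : forall a : extended G, exists x : K, valuation_fun x = a;
  valuation_oo : forall x : K, valuation_fun x = None <-> x = 0;
  valuationM : forall x y : K,
    valuation_fun (x * y) = ext_add (valuation_fun x) (valuation_fun y);
  valuationD : forall x y : K,
    ext_le (ext_min (valuation_fun x) (valuation_fun y)) (valuation_fun (x + y))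
}.

Section Tropical.
Variables (K : fieldType) (G : orderedGroupType) (v : valuation K G).
Implicit Types (f : {poly K}) (g : G).

Definition exponents f : seq nat := [seq j <- iota 0 (size f) | f`_j != 0].

Definition trop_term f g (j : nat) : extended G :=
  ext_add (v f`_j) (Some (g *+ j)).

(* The map g |-> min_j (val f_j + j g) induced by the tropicalization of f;   *)
(* it takes finite values when f != 0, oo being the minimum over the empty    *)
(* set.                                                                       *)
Definition trop_eval f g : extended G :=
  \big[@ext_min G/None]_(j <- exponents f) trop_term f g j.

Definition hypersurface_trop f : set G :=
  [set g | exists i j : nat,
     [/\ i \in exponents f, j \in exponents f, i != j,
         trop_term f g i = trop_eval f g & trop_term f g j = trop_eval f g]].

Definition zeroes f : set K := [set x | x != 0 /\ f.[x] = 0].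

Definition tropical_zeroes f : set G :=
  [set g | exists2 x, zeroes f x & v x = Some g].

End Tropical.

(* Main.v *)
Require Import Defs.
From mathcomp Require Import all_boot all_order all_algebra.
From mathcomp Require Import boolp classical_sets.

(** Fix [t] with [v t = g]. The minimum defining the tropicalization of [f] at
    [g] is attained only once iff one of the monomials [f_i t^i] has valuation
    strictly below all the others. In that case the ultrametric inequality
    forbids [f t = 0]. Conversely, split [f] into linear factors: such a strictly
    dominant monomial survives multiplication by ['X - a] as soon as
    [v a != v t], its index moving up by one if [v t < v a] and staying put if
    [v a < v t]. So if no root has valuation [g], then a dominant monomial
    exists. *)

Import Order.TTheory GRing.Theory Num.Theory.

Local Open Scope ring_scope.

(** * Order, addition and finite minima on [extended G] *)

Definition ext_lt {G : orderedGroupType} (a b : extended G) : bool :=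
  ~~ ext_le b a.

Lemma orderedGroup_leD2r {G : orderedGroupType} (x y z : G) :
  (x + z <= y + z) = (x <= y).
Proof.
apply/idP/idP; last exact: ordered_group_leD.
by move=> /(ordered_group_leD _ _ (- z)); rewrite !addrK.
Qed.

(** Adding [x] to [0 <= x] gives [x <= x + x = 0], and symmetrically; this absence of 2-torsion is
    what determines [v (-1)]. *)
Lemma orderedGroup_double_eq0 {G : orderedGroupType} (x : G) :
  x + x = 0 -> x = 0.
Proof.
move=> x2; have /orP [x0|x0] := ordered_group_total 0 x; apply/le_anti.
- by have := ordered_group_leD _ _ x x0; rewrite add0r x2 x0 => ->.
- by have := ordered_group_leD _ _ x x0; rewrite add0r x2 x0 => ->.
Qed.

Lemma ext_le_refl {G : orderedGroupType} (a : extended G) : ext_le a a.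
Proof. by case: a => /=. Qed.

Lemma ext_le_trans {G : orderedGroupType} (b a c : extended G) :
  ext_le a b -> ext_le b c -> ext_le a c.
Proof. by case: a b c => [a|] [b|] [c|] //=; apply: le_trans. Qed.

Lemma ext_le_anti {G : orderedGroupType} (a b : extended G) :
  ext_le a b -> ext_le b a -> a = b.
Proof.
by case: a b => [a|] [b|] //= ab ba; congr Some; apply/le_anti; rewrite ab ba.
Qed.

Lemma ext_le_total {G : orderedGroupType} (a b : extended G) :
  ext_le a b || ext_le b a.
Proof. by case: a b => [a|] [b|] //=; apply: ordered_group_total. Qed.

Lemma ext_ltW {G : orderedGroupType} (a b : extended G) :
  ext_lt a b -> ext_le a b.
Proof. by rewrite /ext_lt; case/orP: (ext_le_total a b) => ->. Qed.

Lemma ext_lt_irr {G : orderedGroupType} (a : extended G) : ext_lt a a = false.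
Proof. by rewrite /ext_lt ext_le_refl. Qed.

Lemma ext_lt_neqAle {G : orderedGroupType} (a b : extended G) :
  a <> b -> ext_le a b -> ext_lt a b.
Proof. by move=> neq ab; apply/negP => /(ext_le_anti _ _ ab). Qed.

Lemma ext_lt_le_trans {G : orderedGroupType} (b a c : extended G) :
  ext_lt a b -> ext_le b c -> ext_lt a c.
Proof. by move=> ab bc; apply: contra ab; apply: ext_le_trans. Qed.

Lemma ext_min_le {G : orderedGroupType} (a b : extended G) :
  ext_le (ext_min a b) a /\ ext_le (ext_min a b) b.
Proof.
rewrite /ext_min; have := ext_le_total a b.
by case: ifP => /= [ab _|_ ba]; rewrite ext_le_refl.
Qed.

(** Adding oo would destroy strictness, so [a] must be finite; [c] is finite already, as nothing
    lies strictly above oo. *)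
Lemma ext_le_lt_add {G : orderedGroupType} (a b c d : extended G) :
  a <> None -> ext_le a b -> ext_lt c d -> ext_lt (ext_add a c) (ext_add b d).
Proof.
rewrite /ext_lt; case: a b c d => [a|] [b|] [c|] [d|] //= _ ab.
apply: contra => h; rewrite -(orderedGroup_leD2r _ _ a) ![_ + a]addrC.
by apply: le_trans h; rewrite orderedGroup_leD2r.
Qed.

Lemma big_ext_min_le {G : orderedGroupType} {I : eqType} (F : I -> extended G)
    (s : seq I) (i : I) :
  i \in s -> ext_le (\big[@ext_min G/None]_(j <- s) F j) (F i).
Proof.
elim: s => // k s IHs; rewrite big_cons inE => /predU1P [->|/IHs le_i].
  exact: (ext_min_le _ _).1.
exact: ext_le_trans (ext_min_le _ _).2 le_i.
Qed.

Lemma big_ext_min_attained {G : orderedGroupType} {I : eqType}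
    (F : I -> extended G) (s : seq I) :
  \big[@ext_min G/None]_(j <- s) F j <> None ->
  exists2 i, i \in s & F i = \big[@ext_min G/None]_(j <- s) F j.
Proof.
elim: s => [|k s IHs]; first by rewrite big_nil.
rewrite big_cons /ext_min; case: ifP => [_ _|_ /IHs [i si Fi]].
  by exists k; rewrite ?mem_head.
by exists i; rewrite // inE si orbT.
Qed.

(** * Ultrametric calculus of a valuation *)

Lemma valuation1 {K : fieldType} {G : orderedGroupType} (v : valuation K G) :
  v 1 = Some 0.
Proof.
have := valuationM v 1 1; rewrite mulr1.
case E: (v 1) => [g|] /=; last by move/valuation_oo/eqP: E; rewrite oner_eq0.
by case=> /eqP; rewrite -{1}[g]addr0 => /eqP/addrI <-.
Qed.

(** From [(-1) * (-1) = 1] the value of [-1] doubles to [0], hence is [0]. *)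
Lemma valuationN {K : fieldType} {G : orderedGroupType} (v : valuation K G)
    (x : K) :
  v (- x) = v x.
Proof.
have vN1 : v (-1) = Some 0.
  have := valuationM v (-1) (-1); rewrite mulrNN mulr1 valuation1.
  by case: (v (-1)) => [g|] //= [] /esym/orderedGroup_double_eq0 ->.
by rewrite -mulN1r valuationM vN1; case: (v x) => //= g; rewrite add0r.
Qed.

Lemma valuation0 {K : fieldType} {G : orderedGroupType} (v : valuation K G) :
  v 0 = None.
Proof. exact/valuation_oo. Qed.

Lemma valuation_neq0 {K : fieldType} {G : orderedGroupType}
    (v : valuation K G) (x : K) :
  x != 0 -> v x <> None.
Proof. by move=> /eqP x0 /valuation_oo. Qed.

Lemma valuationX {K : fieldType} {G : orderedGroupType} (v : valuation K G)
    (t : K) (g : G) (n : nat) :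
  v t = Some g -> v (t ^+ n) = Some (g *+ n).
Proof.
move=> vt; elim: n => [|n IHn]; first by rewrite expr0 valuation1.
by rewrite exprS valuationM IHn vt /= mulrS.
Qed.

Lemma valuation_ltD {K : fieldType} {G : orderedGroupType} (v : valuation K G)
    (c : extended G) (x y : K) :
  ext_lt c (v x) -> ext_lt c (v y) -> ext_lt c (v (x + y)).
Proof.
move=> cx cy; apply: ext_lt_le_trans (valuationD v x y).
by rewrite /ext_min; case: ifP.
Qed.

(** The bound survives each addition; finiteness of [c] settles the empty sum, whose valuation is
    oo. *)
Lemma valuation_sum_lt {K : fieldType} {G : orderedGroupType}
    (v : valuation K G) (c : extended G) (I : Type) (s : seq I) (P : pred I)
    (F : I -> K) :
  c <> None -> (forall i, P i -> ext_lt c (v (F i))) ->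
  ext_lt c (v (\sum_(i <- s | P i) F i)).
Proof.
move=> c0 cF; elim/big_ind: _ => //; last exact: valuation_ltD.
by rewrite valuation0; case: c c0 {cF}.
Qed.

(** Otherwise [v (x + y)] would exceed [v x], and [x = (x + y) - y] would be a sum of two elements
    of valuation strictly above [v x]. *)
Lemma valuationDl {K : fieldType} {G : orderedGroupType} (v : valuation K G)
    (x y : K) :
  ext_lt (v x) (v y) -> v (x + y) = v x.
Proof.
move=> xy; apply: contraPP (ext_lt_irr (v x)) => neq.
have le_x : ext_le (v x) (v (x + y)).
  apply: ext_le_trans (valuationD v x y).
  by rewrite /ext_min (ext_ltW _ _ xy) ext_le_refl.
rewrite -{2}[x](addrK y) valuation_ltD ?valuationN //.
exact: ext_lt_neqAle (nesym neq) le_x.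
Qed.

(** * Strictly dominant monomials and linear factors *)

Definition dominant_monomial {K : fieldType} {G : orderedGroupType}
    (v : valuation K G) (f : {poly K}) (t : K) (i : nat) : Prop :=
  forall j, j != i -> ext_lt (v (f`_i * t ^+ i)) (v (f`_j * t ^+ j)).

(** Dominance ranges over all indices, vanishing coefficients giving oo; so some other index always
    exists, here [i.+1], and being strictly below its value forces finiteness. *)
Lemma dominant_monomial_neq0 {K : fieldType} {G : orderedGroupType}
    {v : valuation K G} {f : {poly K}} {t : K} {i : nat} :
  dominant_monomial v f t i -> f`_i * t ^+ i != 0.
Proof.
move=> /(_ i.+1); rewrite gtn_eqF // => /(_ isT).
by apply: contraL => /eqP ->; rewrite valuation0 /ext_lt; case: (v _).
Qed.

Lemma dominant_monomial_le {K : fieldType} {G : orderedGroupType}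
    {v : valuation K G} {f : {poly K}} {t : K} {i : nat} (j : nat) :
  dominant_monomial v f t i ->
  ext_le (v (f`_i * t ^+ i)) (v (f`_j * t ^+ j)).
Proof.
by move=> dom; have [->|/dom/ext_ltW //] := eqVneq j i; apply: ext_le_refl.
Qed.

Lemma dominant_monomial_nonroot {K : fieldType} {G : orderedGroupType}
    (v : valuation K G) (f : {poly K}) (t : K) (i : nat) :
  dominant_monomial v f t i -> f.[t] != 0.
Proof.
move=> dom; have fi0 := dominant_monomial_neq0 dom.
have lt_i : (i < size f)%N.
  by rewrite ltnNge; apply: contra fi0 => le; rewrite nth_default ?mul0r.
rewrite horner_coef (bigD1 (Ordinal lt_i)) //=.
apply/eqP => /(valuation_oo v); rewrite valuationDl.
  exact: valuation_neq0.
apply: valuation_sum_lt => [|j ji]; first exact: valuation_neq0.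
exact: dom.
Qed.

(** With [u_j] for the monomial [f_j t^j], multiplying by 'X shifts the index at the cost of a
    factor [t], giving [t u_(j-1) - a u_j]. Nothing is shifted into index 0, hence the default
    [0]. *)
Lemma coef_XsubC_mul_exp {K : fieldType} (f : {poly K}) (a t : K) (j : nat) :
  (('X - a%:P) * f)`_j * t ^+ j =
  (if j is k.+1 then t * (f`_k * t ^+ k) else 0) - a * (f`_j * t ^+ j).
Proof.
rewrite mulrBl coefB coefXM coefCM mulrBl mulrA; congr (_ - _).
by case: j => [|j]; rewrite ?mul0r //= exprS mulrCA.
Qed.

Lemma dominant_monomial_XsubC_mul {K : fieldType} {G : orderedGroupType}
    (v : valuation K G) (f : {poly K}) (a t : K) (i : nat) :
  t != 0 -> v a <> v t -> dominant_monomial v f t i ->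
  exists k, dominant_monomial v (('X - a%:P) * f) t k.
Proof.
move=> t0 vat dom.
have ui0 := valuation_neq0 v _ (dominant_monomial_neq0 dom).
(* Strictness has two sources: a different index ([mul_lt]), or a multiplier of smaller valuation
   ([lt_mul]), which also allows [j = i]. *)
have mul_lt x y j : x != 0 -> ext_le (v x) (v y) -> j != i ->
    ext_lt (v (x * (f`_i * t ^+ i))) (v (y * (f`_j * t ^+ j))).
  move=> x0 xy ji; rewrite !(valuationM v x) !(valuationM v y).
  by apply: ext_le_lt_add (dom _ ji) => //; apply: valuation_neq0.
have lt_mul x y j : ext_lt (v x) (v y) ->
    ext_lt (v (x * (f`_i * t ^+ i))) (v (y * (f`_j * t ^+ j))).
  move=> xy; rewrite (mulrC x) (mulrC y) (valuationM v _ x) (valuationM v _ y).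
  by apply: ext_le_lt_add (dominant_monomial_le j dom) xy.
case/orP: (ext_le_total (v a) (v t)) => [le_at|le_ta].
- have lt_at := ext_lt_neqAle _ _ vat le_at.
  have a0 : a != 0.
    by apply: contraTneq lt_at => ->; rewrite valuation0 /ext_lt; case: (v t).
  have au0 : v (a * (f`_i * t ^+ i)) <> None.
    by apply: valuation_neq0; rewrite mulf_neq0 ?(dominant_monomial_neq0 dom).
  have lt_shift j : ext_lt (v (a * (f`_i * t ^+ i)))
      (v (if j is k.+1 then t * (f`_k * t ^+ k) else 0)).
    case: j => [|j]; last exact: lt_mul.
    by rewrite valuation0; case: (v _) au0.
  (* The term [a u_i] dominates: every shifted term [t u_(j-1)], even [t u_i], loses by its
     multiplier, and [a u_j] with [j != i] loses by its index. *)
  exists i => j ji; rewrite !coef_XsubC_mul_exp.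
  rewrite [X in v X]addrC [X in ext_lt X _]valuationDl ?valuationN //.
  apply: valuation_ltD; first exact: lt_shift.
  by rewrite valuationN; apply: mul_lt; rewrite ?ext_le_refl.
- have lt_ta := ext_lt_neqAle _ _ (nesym vat) le_ta.
  have tu0 : v (t * (f`_i * t ^+ i)) <> None.
    by apply: valuation_neq0; rewrite mulf_neq0 ?(dominant_monomial_neq0 dom).
  (* Now [t u_i] dominates, and it sits at index [i.+1]: every [a u_j] loses by its multiplier, and
     [t u_(j-1)] with [j - 1 != i] by its index. *)
  exists i.+1 => j ji; rewrite !coef_XsubC_mul_exp.
  rewrite [X in ext_lt X _]valuationDl ?valuationN; last exact: lt_mul.
  apply: valuation_ltD; rewrite ?valuationN; last exact: lt_mul.
  case: j ji => [_|j ji]; last by apply: mul_lt; rewrite ?ext_le_refl.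
  by rewrite valuation0; case: (v _) tu0.
Qed.

Lemma dominant_monomial_exists {K : closedFieldType} {G : orderedGroupType}
    (v : valuation K G) (f : {poly K}) (t : K) :
  f != 0 -> t != 0 -> (forall x, root f x -> v x <> v t) ->
  exists i, dominant_monomial v f t i.
Proof.
move=> f0 t0; have [r ->] := closed_field_poly_normal f.
have c0 : lead_coef f != 0 by rewrite lead_coef_eq0.
move: (lead_coef f) c0 => c c0.
(* Phrased by membership in the list of roots, the hypothesis passes to the tail in the
   induction. *)
have -> : (forall x, root (c *: \prod_(z <- r) ('X - z%:P)) x -> v x <> v t) =
    (forall x, x \in r -> v x <> v t).
  by congr (forall x, _); apply/funext => x; rewrite rootZ // root_prod_XsubC.
elim: r => [|a r IHr] vr.
  (* For the constant [c], every monomial of positive index is zero, of valuation oo. *)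
  exists 0%N => j j0; rewrite big_nil alg_polyC !coefC eqxx (negPf j0) mul0r.
  have := valuation_neq0 v _ c0; rewrite expr0 mulr1 valuation0.
  by case: (v c).
have [|i dom] := IHr; first by move=> x xr; apply: vr; rewrite inE xr orbT.
rewrite big_cons scalerAr; apply: dominant_monomial_XsubC_mul dom => //.
by apply: vr; rewrite mem_head.
Qed.

(** * Tropical terms as valuations of monomials *)

Lemma trop_termE {K : fieldType} {G : orderedGroupType} (v : valuation K G)
    (f : {poly K}) (t : K) (g : G) (j : nat) :
  v t = Some g -> trop_term v f g j = v (f`_j * t ^+ j).
Proof. by move=> vt; rewrite valuationM (valuationX v t g). Qed.

Lemma mem_exponents {K : fieldType} (f : {poly K}) (j : nat) :
  (j \in exponents f) = (f`_j != 0).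
Proof.
rewrite mem_filter mem_iota /= add0n andb_idr // => fj0.
by rewrite ltnNge; apply: contra fj0 => le; rewrite nth_default.
Qed.

Lemma trop_term_finite {K : fieldType} {G : orderedGroupType}
    (v : valuation K G) (f : {poly K}) (g : G) (j : nat) :
  trop_term v f g j <> None <-> j \in exponents f.
Proof.
rewrite mem_exponents /trop_term; split.
  by apply: contra_notN => /eqP ->; rewrite valuation0.
by move=> /(valuation_neq0 v); case: (v _).
Qed.

Lemma trop_eval_le {K : fieldType} {G : orderedGroupType} (v : valuation K G)
    (f : {poly K}) (g : G) (j : nat) :
  ext_le (trop_eval v f g) (trop_term v f g j).
Proof.
have [jf|nj] := boolP (j \in exponents f); first exact: big_ext_min_le.
case E: (trop_term v f g j) => [a|]; last by case: (trop_eval _ _ _).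
by case/negP: nj; apply/(trop_term_finite v f g); rewrite E.
Qed.

Lemma trop_eval_attained {K : fieldType} {G : orderedGroupType}
    (v : valuation K G) (f : {poly K}) (g : G) :
  f != 0 ->
  exists2 i, i \in exponents f & trop_term v f g i = trop_eval v f g.
Proof.
move=> f0; apply: big_ext_min_attained; rewrite -/(trop_eval v f g) => E.
(* The leading exponent contributes a finite term, so the minimum is not oo. *)
have /(trop_term_finite v f g) : (size f).-1 \in exponents f.
  by rewrite mem_exponents lead_coef_eq0.
apply; have := trop_eval_le v f g (size f).-1; rewrite E.
by case: (trop_term _ _ _ _).
Qed.

(** A dominant index is the only possible minimizer. Conversely, if a minimizer [i] is not dominant,
    some [j != i] has a term at most the minimum, hence equal to it and finite. *)
Lemma hypersurface_tropP {K : fieldType} {G : orderedGroupType}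
    (v : valuation K G) (f : {poly K}) (t : K) (g : G) :
  f != 0 -> v t = Some g ->
  hypersurface_trop v f g <-> ~ exists i, dominant_monomial v f t i.
Proof.
move=> f0 vt; split=> [[i [j [_ _ ij Ti Tj]]] [k dom]|ndom].
  have attained_dominant l : trop_term v f g l = trop_eval v f g -> l = k.
    move=> Tl; have [//|/dom] := eqVneq l k.
    by rewrite -!(trop_termE _ _ _ _ _ vt) Tl /ext_lt trop_eval_le.
  by move/eqP: ij; rewrite (attained_dominant i Ti) (attained_dominant j Tj).
have [i fi Ti] := trop_eval_attained v f g f0.
have /existsNP [j /not_implyP [ji /negP]] : ~ dominant_monomial v f t i.
  by move=> dom; apply: ndom; exists i.
rewrite negbK -!(trop_termE _ _ _ _ _ vt) Ti => le_j.
have Tj := ext_le_anti _ _ le_j (trop_eval_le v f g j).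
exists i, j; split; rewrite // 1?eq_sym //.
by apply/(trop_term_finite v f g); rewrite Tj -Ti; apply/trop_term_finite.
Qed.

Theorem corollary5p3 (K : closedFieldType) (G : orderedGroupType)
    (v : valuation K G) (f : {poly K}) (hf : f != 0) :
  hypersurface_trop v f = tropical_zeroes v f.
Proof.
have finite_neq0 x g : v x = Some g -> x != 0.
  by move=> vx; apply/eqP => /(valuation_oo v); rewrite vx.
apply/seteqP; split=> g.
  (* Surjectivity lifts [g] to a [t] at which monomials can be compared; it need not be a root. *)
  have [t vt] := valuation_surj v (Some g).
  move=> /(hypersurface_tropP v f t g hf vt); apply: contra_notP => no_root.
  apply: dominant_monomial_exists (finite_neq0 t g vt) _ => // x /rootP fx vx.
  apply: no_root; exists x; last by rewrite vx.
  by split=> //; apply: (finite_neq0 x g); rewrite vx.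
(* Here the root [x] itself serves as the lift of [g]. *)
move=> [x [x0 fx] vx]; apply/(hypersurface_tropP v f x g hf vx) => -[i].
by move=> /dominant_monomial_nonroot; rewrite fx eqxx.
Qed.
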